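(* There do not exist univariate polynomials $f$ and $g$ with complex coefficients such that \[ \mathrm{sz}_{(2,1)}(z_1,z_2)=\frac{\left|\begin{array}{cc}f(z_1)&f(z_2)\\ g(z_1)&g(z_2)\end{array}\right|}{z_1-z_2}. \]
   Context: $\mathrm{sz}_{(2,1)}(z_1,z_2)$ is the unique symmetric polynomial in two variables over $\mathbb{C}$ satisfying $\mathrm{sz}_{(2,1)}(x_1+x_1^{-1},x_2+x_2^{-1})=\mathrm{s}_{(2,1)}(x_1,x_2,x_1^{-1},x_2^{-1})$ as Laurent polynomials in $x_1,x_2$, where $\mathrm{s}_{(2,1)}$ is the Schur polynomial of the partition $(2,1)$ in four variables. *)

(* Defs.v *)
From HB Require Import structures.
From mathcomp Require Import all_boot all_order all_algebra.
From mathcomp Require Import fraction.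
From mathcomp Require Import reals complex mpoly ring zify.

Set Implicit Arguments.
Unset Strict Implicit.
Unset Printing Implicit Defensive.

Import Order.TTheory GRing.Theory.
Local Open Scope ring_scope.

Section Schur.

Variables (n : nat) (la : seq nat).

(* Young diagram of [la]; the column bound [sumn la] only ensures finiteness. *)
Definition cells : finType :=
  {c : 'I_(size la) * 'I_(sumn la) | (c.2 < nth 0 la c.1)%N}.

Definition semistandard (T : {ffun cells -> 'I_n}) : bool :=
  [forall c : cells, forall d : cells,
     (((val c).1 == (val d).1) && ((val c).2 <= (val d).2)%N
        ==> (T c <= T d)%N)
  && (((val c).2 == (val d).2) && ((val c).1 < (val d).1)%N
        ==> (T c < T d)%N)].

Definition schur (R : nzRingType) : {mpoly R[n]} :=
  \sum_(T : {ffun cells -> 'I_n} | semistandard T) \prod_(c : cells) 'X_(T c).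

End Schur.

Section Sz.

Variable F : fieldType.

(* The Laurent polynomial ring F[x_i^{+-1}] is viewed inside the field of
   rational functions in the x_i. *)
Definition ratfun n : fieldType := {fraction {mpoly F[n]}}.

Definition rvar n (i : 'I_n) : ratfun n := tofrac ('X_i : {mpoly F[n]}).

Definition rsubst m n (h : 'I_m -> ratfun n) (p : {mpoly F[m]}) : ratfun n :=
  mmap (@tofrac _ \o @mpolyC n F) h p.

Lemma rsubst_is_zmod_morphism m n (h : 'I_m -> ratfun n) :
  zmod_morphism (rsubst h).
Proof. exact: mmap_is_additive. Qed.

Lemma rsubst_is_monoid_morphism m n (h : 'I_m -> ratfun n) :
  monoid_morphism (rsubst h).
Proof.
by have [hM h1] := mmap_is_multiplicative h (@tofrac _ \o @mpolyC n F); split.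
Qed.

HB.instance Definition _ m n (h : 'I_m -> ratfun n) :=
  GRing.isZmodMorphism.Build {mpoly F[m]} (ratfun n) (rsubst h)
    (rsubst_is_zmod_morphism h).
HB.instance Definition _ m n (h : 'I_m -> ratfun n) :=
  GRing.isMonoidMorphism.Build {mpoly F[m]} (ratfun n) (rsubst h)
    (rsubst_is_monoid_morphism h).

(* The substitution (x_1, ..., x_n, x_1^-1, ..., x_n^-1). *)
Definition var_inv n (k : 'I_(n + n)) : ratfun n :=
  match split k with inl i => rvar i | inr i => (rvar i)^-1 end.

Definition is_sz n (la : seq nat) (p : {mpoly F[n]}) : bool :=
  (p \is symmetric) &&
  (rsubst (fun i => rvar i + (rvar i)^-1) p ==
     rsubst (@var_inv n) (schur (n + n) la F)).

End Sz.

Section Hook.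
Variable n : nat.

Local Notation D := (cells [:: 2; 1]%N).
Definition c00 : D := exist _ (@Ordinal 2 0 isT, @Ordinal 3 0 isT) isT.
Definition c01 : D := exist _ (@Ordinal 2 0 isT, @Ordinal 3 1 isT) isT.
Definition c10 : D := exist _ (@Ordinal 2 1 isT, @Ordinal 3 0 isT) isT.

Lemma cellsP (c : D) : [\/ c = c00, c = c01 | c = c10].
Proof.
case: c => -[[[|[|//]] i] [[|[|[|//]]] j]] //= h;
  [constructor 1|constructor 2|constructor 3]; exact/val_inj/eqP.
Qed.

Lemma big_cells (R : comNzRingType) (G : D -> R) :
  \prod_c G c = G c00 * G c01 * G c10.
Proof.
rewrite (bigD1 c00) //= (bigD1 c01) //= (bigD1 c10) //= big1 ?mulr1 ?mulrA //.
by move=> c; case: (cellsP c) => ->.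
Qed.

Lemma schur21E (R : comNzRingType) : schur n [:: 2; 1]%N R =
  \sum_(a < n) \sum_(b < n) \sum_(c < n)
    if (a <= b)%N && (a < c)%N then 'X_a * 'X_b * 'X_c else 0.
Proof.
pose h (u : 'I_n * 'I_n * 'I_n) : {ffun D -> 'I_n} :=
  [ffun c => if c == c00 then u.1.1 else if c == c01 then u.1.2 else u.2].
pose g (T : {ffun D -> 'I_n}) := (T c00, T c01, T c10).
have hK : cancel h g by case=> -[a b] c; rewrite /g /h !ffunE.
have gK : cancel g h.
  by move=> T; apply/ffunP=> c; rewrite ffunE /=; case: (cellsP c) => ->.
rewrite pair_big /= pair_big /= -big_mkcond /=.
rewrite /schur (reindex h) /=; last by exists g => u _.
apply: eq_big => [[[a b] c]|[[a b] c] _] /=; last by rewrite big_cells !ffunE.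
apply/forallP/andP => [H|[ab ac] d].
  split; first by move/forallP: (H c00) => /(_ c01); rewrite !ffunE /=;
    case/andP.
  by move/forallP: (H c00) => /(_ c10); rewrite !ffunE /=.
apply/forallP=> e.
by case: (cellsP d) => ->; case: (cellsP e) => ->; rewrite !ffunE /= ?leqnn ?ab ?ac.
Qed.
End Hook.

Lemma schur21_eval (K : fieldType) (x y : K) : x != 0 -> y != 0 ->
  let v := nth 0 [:: x; y; x^-1; y^-1] in
  let z1 := x + x^-1 in let z2 := y + y^-1 in
  \sum_(a < 4) \sum_(b < 4) \sum_(c < 4)
    (if (a <= b)%N && (a < c)%N then v a * v b * v c else 0) =
  (z1 + z2) * (z1 * z2 + 1).
Proof.
move=> x0 y0 v z1 z2; rewrite {}/v {}/z1 {}/z2 !big_ord_recl !big_ord0 /= /bump /=.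
by field; rewrite y0.
Qed.

Section Sz21.

Variable F : fieldType.

Lemma rsubstX m n (h : 'I_m -> ratfun F n) i : rsubst h 'X_i = h i.
Proof. by rewrite /rsubst mmapX mmap1U. Qed.


Lemma is_sz21 :
  is_sz [:: 2; 1]%N (mesym 2 F 1 * (mesym 2 F 2 + 1)).
Proof.
apply/andP; split.
  by apply: rpredM; rewrite ?rpredD ?rpred1 // mesym_sym.
rewrite schur21E mesym1E (mesymnnE 2).
rewrite rmorphM rmorphD rmorph1 !rmorph_sum rmorph_prod /=.
set h := @var_inv F 2.
pose v k := nth 0 [:: rvar F 0; rvar F 1; (rvar F 0)^-1; (rvar F 1)^-1 : ratfun F 2] k.
have hE (i : 'I_4) : h i = v i.
  rewrite /h /var_inv; case: splitP => j ->; case: j => -[|[|//]] jlt /=;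
   [congr rvar | congr rvar | congr (rvar _ _)^-1 | congr (rvar _ _)^-1]; exact/val_inj.
have -> : \sum_(a < 4) rsubst h (\sum_(b < 4) \sum_(c < 4)
    if (a <= b)%N && (a < c)%N then 'X_a * 'X_b * 'X_c else 0) =
  \sum_(a < 4) \sum_(b < 4) \sum_(c < 4)
    if (a <= b)%N && (a < c)%N then v a * v b * v c else 0.
  apply: eq_bigr => a _.
  rewrite rmorph_sum; apply: eq_bigr => b _.
  rewrite rmorph_sum; apply: eq_bigr => c _.
  case: ifP => _; last by rewrite raddf0.
  by rewrite !rmorphM /= !rsubstX !hE.
have x_neq0 (i : 'I_2) : rvar F i != 0 by rewrite tofrac_eq0 -msupp_eq0 msuppX.
rewrite schur21_eval ?x_neq0 // !big_ord_recl !big_ord0 !rsubstX.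
have -> : lift ord0 ord0 = 1 :> 'I_2 by exact/val_inj.
by rewrite addr0 mulr1.
Qed.

(* The kernel of x_i |-> x_i + x_i^-1 is trivial: clear denominators and compare
   leading monomials. *)
Lemma rsubst_inj n :
  injective (rsubst (fun i : 'I_n => rvar F i + (rvar F i)^-1)).
Proof.
set h := fun i => _.
apply/raddf_inj => p hp; apply/eqP/negPn/negP => p0.
pose N := msize p.
pose t (m : 'X_{1..n}) : {mpoly F[n]} :=
  \prod_(i < n) (('X_i ^+ 2 + 1) ^+ m i * 'X_i ^+ (N - m i)).
have rv0 (i : 'I_n) : rvar F i != 0 by rewrite tofrac_eq0 -msupp_eq0 msuppX.
have b_lead (i : 'I_n) : mlead ('X_i ^+ 2 + 1 : {mpoly F[n]}) = (U_(i) *+ 2)%MM.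
  have e2 : mlead ('X_i ^+ 2 : {mpoly F[n]}) = (U_(i) *+ 2)%MM.
    by rewrite mpolyXn mleadXm.
  rewrite mleadDl ?e2 // mlead1.
  rewrite lt_neqAle le0m andbT; apply/eqP => /mnmP /(_ i).
  by rewrite mulmnE mnm1E eqxx mnm0E.
have b0 (i : 'I_n) : ('X_i ^+ 2 + 1 : {mpoly F[n]}) != 0.
  apply/negP => /eqP e; move: (b_lead i); rewrite e mlead0 => /mnmP /(_ i).
  by rewrite mulmnE mnm1E eqxx mnm0E.
have X0 (i : 'I_n) : ('X_i : {mpoly F[n]}) != 0 by rewrite -msupp_eq0 msuppX.
have t0 m : t m != 0.
  by apply/prodf_neq0 => i _; rewrite mulf_neq0 ?expf_neq0.
have leN m (i : 'I_n) : m \in msupp p -> (m i <= N)%N.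
  move=> /msize_mdeg_lt /ltnW; apply: leq_trans.
  by rewrite mdegE (bigD1 i) //= leq_addr.
have t_lead m : m \in msupp p -> mlead (t m) = ([multinom N | i < n] + m)%MM.
  move=> mp; rewrite /t mlead_prod => [|i _ _]; last first.
    by rewrite mulf_neq0 ?expf_neq0.
  rewrite (eq_bigr (fun i : 'I_n => U_(i) *+ (N + m i))%MM) => [|i _].
    rewrite [RHS]multinomUE_id; apply: eq_bigr => i _.
    by rewrite mnmDE mnmE.
  rewrite mleadM ?expf_neq0 // !mleadX // b_lead mleadXm.
  apply/mnmP => j; rewrite mnmDE !mulmnE.
  by rewrite mnm1E; have := leN m i mp; case: (_ == _) => /=; lia.
have eQ : tofrac (\prod_(i < n) 'X_i ^+ N) * rsubst h p =
          tofrac (\sum_(m <- msupp p) p@_m *: t m).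
  rewrite /rsubst /mmap mulr_sumr rmorph_sum; apply: eq_big_seq => m mp /=.
  rewrite -mul_mpolyC rmorphM mulrCA; congr (_ * _).
  rewrite /mmap1 !rmorph_prod -big_split /=; apply: eq_bigr => i _.
  rewrite !(rmorphM, rmorphXn, rmorphD, rmorph1) -/(rvar F i) /h /=.
  rewrite -{1}(subnKC (leN m i mp)) exprD mulrAC -exprMn mulrDr -expr2 mulfV; last exact: rv0.
  by rewrite mulrC.
move: eQ; rewrite hp mulr0 => /esym/eqP; rewrite tofrac_eq0 => /eqP Q0.
have : (\sum_(m <- msupp p) p@_m *: t m)@_([multinom N | i < n] + mlead p)%MM = 0.
  by rewrite Q0 mcoeff0.
have lp := mlead_supp p0.
rewrite raddf_sum /= (bigD1_seq (mlead p)) ?msupp_uniq //= big_seq_cond big1.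
  rewrite addr0 mcoeffZ -t_lead // => /eqP.
  by rewrite mulf_eq0 !mleadc_eq0 (negbTE p0) (negbTE (t0 _)).
move=> m /andP[mp mn]; rewrite mcoeffZ (@mcoeff_gt_mlead _ _ (t m)) ?mulr0 // t_lead //.
by rewrite ltmc_add2r lt_neqAle mn msupp_le_mlead.
Qed.

Lemma is_sz_unique n (la : seq nat) (p q : {mpoly F[n]}) :
  is_sz la p -> is_sz la q -> p = q.
Proof. by case/andP=> _ /eqP hp /andP[_ /eqP hq]; apply: rsubst_inj; rewrite hp. Qed.

Lemma ex_sz21 : exists p : {mpoly F[2]}, is_sz [:: 2; 1]%N p.
Proof. by exists (mesym 2 F 1 * (mesym 2 F 2 + 1)); exact: is_sz21. Qed.

(* [is_sz_unique] makes the choice irrelevant. *)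
Definition sz21 : {mpoly F[2]} := xchoose ex_sz21.

Lemma sz21P : is_sz [:: 2; 1]%N sz21.
Proof. exact: xchooseP. Qed.

End Sz21.

(* Main.v *)
Require Import Defs.
From mathcomp Require Import all_boot all_order all_algebra.
From mathcomp Require Import fraction.
From mathcomp Require Import reals complex mpoly ring.

Import GRing.Theory.
Local Open Scope ring_scope.

(** A function of the form [f a * g b - f b * g a] is a family of 2 x 2 minors,
    so its values at four points satisfy the three-term Plücker relation
    ([minors_plucker]).  A bialternant formula for [sz_(2,1)] would present
    [(a - b) * sz_(2,1)(a, b)] in this way.  Since
    [sz_(2,1)(a, b) = (a + b) * (a * b + 1)], this function is
    [(a ^ 2 - b ^ 2) * (a * b + 1)], an alternating form of rank 4 in
    1, z, z^2, z^3; it violates the Plücker relation, for instance at the points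
    0, 1, -1, 2, where the left-hand side of the relation equals -12.
    The argument works over every field in which 12 is nonzero. *)

(** Cramer's rule for the plane vectors [v x = (f x, g x)] gives the linear
    relation [m c d * v b - m b d * v c + m b c * v d = 0]; take its minor with
    [v a]. *)
Lemma minors_plucker (K : comNzRingType) (T : Type) (f g : T -> K) (a b c d : T) :
  let m x y := f x * g y - f y * g x in
  m a b * m c d - m a c * m b d + m a d * m b c = 0.
Proof. by move=> m; rewrite /m; ring. Qed.

Lemma sz21_eval (F : fieldType) (v : 'I_2 -> F) :
  (sz21 F).@[v] = (v 0 + v 1) * (v 0 * v 1 + 1).
Proof.
rewrite (@is_sz_unique _ _ _ _ _ (sz21P F) (is_sz21 F)).
rewrite mesym1E (mesymnnE 2) !big_ord_recl !big_ord0 addr0 mulr1.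
have -> : lift ord0 ord0 = 1 :> 'I_2 by exact/val_inj.
by rewrite mevalM !mevalD mevalM meval1 !mevalXU.
Qed.

Lemma det_mx2 (K : comNzRingType) (A : 'M[K]_2) :
  \det A = A 0 0 * A 1 1 - A 0 1 * A 1 0.
Proof.
rewrite (expand_det_row A 0) !big_ord_recl big_ord0 addr0 /cofactor !det_mx11.
rewrite !mxE /= expr0 expr1 mul1r mulN1r mulrN.
by congr (A _ _ * A _ _ - A _ _ * A _ _); exact/val_inj.
Qed.

Lemma meval_horner_alg (F : comNzRingType) n (v : 'I_n -> F) (j : 'I_n)
    (p : {poly F}) :
  (horner_alg ('X_j : {mpoly F[n]}) p).@[v] = p.[v j].
Proof.
elim/poly_ind: p => [|p c IH]; first by rewrite rmorph0 meval0 horner0.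
rewrite rmorphD rmorphM /= horner_algC horner_algX mevalD mevalM IH mevalXU.
by rewrite mevalZ meval1 mulr1 hornerMXaddC.
Qed.

Lemma sz21_not_bialternant (F : fieldType) (f g : {poly F}) :
  12%:R != 0 :> F ->
  tofrac (sz21 F) <>
    tofrac (\det (\matrix_(i < 2, j < 2)
              horner_alg ('X_j : {mpoly F[2]}) (if i == 0 then f else g)))
    / tofrac ('X_0 - 'X_1).
Proof.
move=> F12 sz_eq.
have X01 : 'X_0 - 'X_1 != 0 :> {mpoly F[2]}.
  apply/eqP => /(congr1 (meval (fun i : 'I_2 => (i == 0)%:R))).
  rewrite mevalB !mevalXU meval0 /= subr0; apply/eqP; exact: oner_neq0.
have minorE (a b : F) :
    f.[a] * g.[b] - f.[b] * g.[a] = (a - b) * ((a + b) * (a * b + 1)).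
  have := congr1 ( *%R^~ (tofrac ('X_0 - 'X_1))) sz_eq.
  rewrite /= mulfVK ?tofrac_eq0 // -rmorphM => /eqP.
  rewrite tofrac_eq det_mx2 !mxE /= => /eqP.
  move=> /(congr1 (meval (fun i : 'I_2 => if i == 0 then a else b))).
  rewrite mevalB !mevalM mevalB !mevalXU sz21_eval !meval_horner_alg /= => E.
  by rewrite [RHS]mulrC E.
have := minors_plucker F F (horner f) (horner g) 0 1 (-1) 2%:R.
rewrite /= !minorE => P; case/eqP: F12; apply: oppr_inj; rewrite oppr0 -P; ring.
Qed.

Theorem proposition7p5 (R : realType) :
  ~ exists f g : {poly R[i]},
      tofrac (sz21 R[i]) =
        tofrac (\det (\matrix_(i < 2, j < 2)
                  horner_alg ('X_j : {mpoly R[i][2]})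
                    (if i == 0 then f else g)))
        / tofrac ('X_0 - 'X_1).
Proof.
by move=> [f [g]]; apply: sz21_not_bialternant; rewrite Num.Theory.pnatr_eq0.
Qed.
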